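(* Let $m\ge1$, $n\ge0$. The set of rules $\mathcal{O}^m_n\cup\{\frac{}{\top}\}$ axiomatizes $\vdash^{\leq}_{\mathbb{O}^m_n}$, i.e., $\vdash_{\mathcal{O}^m_n\cup\{\frac{}{\top}\}}=\vdash^{\leq}_{\mathbb{O}^m_n}$.
   Context: Language: binary $\land,\lor$, unary $\neg$, constants $\bot,\top$; $Fm$ is the set of formulas over a countably infinite set of variables; $\neg^0\varphi=\varphi$, $\neg^{k+1}\varphi=\neg\neg^k\varphi$. An Ockham algebra is an algebra $\langle A;\land,\lor,\neg,\bot,\top\rangle$ with bounded distributive lattice reduct satisfying $\neg\bot\approx\top$, $\neg(x\lor y)\approx\neg x\land\neg y$, $\neg\top\approx\bot$, $\neg(x\land y)\approx\neg x\lor\neg y$; the Berman variety $\mathbb{O}^m_n$ consists of Ockham algebras satisfying $\neg^{2m+n}x\approx\neg^nx$. $\Gamma\vdash^{\leq}_{\mathbb{O}^m_n}\varphi$ iff for every $\mathbf{A}\in\mathbb{O}^m_n$, every non-empty lattice filter $F$ of $\mathbf{A}$ and every homomorphism $h\colon Fm\to A$, $h[\Gamma]\subseteq F$ implies $h(\varphi)\in F$. $\vdash_{\mathcal{R}}$ denotes Hilbert derivability with substitution instances of rules in $\mathcal{R}$. Let $\mathsf{Eq}^m_n$ be: the bounded distributive lattice axioms ($x\lor y\approx y\lor x$, $x\land y\approx y\land x$, $x\lor(y\lor z)\approx(x\lor y)\lor z$, $x\land(y\land z)\approx(x\land y)\land z$, $x\lor x\approx x$, $x\land x\approx x$, $x\lor(x\land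 y)\approx x$, $x\land(x\lor y)\approx x$, $x\land\bot\approx\bot$, $x\lor\top\approx\top$, $x\land(y\lor z)\approx(x\land y)\lor(x\land z)$), $\neg\bot\approx\top$, $\neg(x\lor y)\approx\neg x\land\neg y$, $\neg\top\approx\bot$, $\neg(x\land y)\approx\neg x\lor\neg y$, $\neg^{2m+n}x\approx\neg^nx$. Let $\mathcal{R}^{\mathsf{Eq}^m_n}=\{\frac{\varphi}{\psi},\frac{\psi}{\varphi}:\varphi\approx\psi\in\mathsf{Eq}^m_n\}$, $\mathcal{R}^{mn}_\land=\mathcal{R}^{\mathsf{Eq}^m_n}\cup\{\frac{p\land q}{p},\frac{p\land q}{q}\}$. For a rule $\mathsf{r}=\frac{\varphi}{\psi}$, fresh variable $t$, and $k<\omega$: $\mathsf{s}_k(\mathsf{r})=\frac{\neg^k\varphi\lor t}{\neg^k\psi\lor t}$ for even $k$, $\mathsf{s}_k(\mathsf{r})=\frac{\neg^k\psi\lor t}{\neg^k\varphi\lor t}$ for odd $k$. $\mathcal{O}^m_n=\mathcal{R}^{mn}_\land\cup\{\mathsf{s}_i(\mathsf{r}):i\le2m+n,\ \mathsf{r}\in\mathcal{R}^{mn}_\land\}\cup\{\frac{p\,,\,q}{p\land q}\}$. *)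

(* Defs.v *)
From HB Require Import structures.
From mathcomp Require Import all_boot all_order.
From mathcomp Require Import classical_sets.

Set Implicit Arguments.
Unset Strict Implicit.
Unset Printing Implicit Defensive.

Local Open Scope classical_set_scope.

Inductive fm : Type :=
| Var of nat
| Bot
| Top
| Neg of fm
| And of fm & fm
| Or of fm & fm.

Declare Scope fm_scope.
Delimit Scope fm_scope with F.
Bind Scope fm_scope with fm.
Notation "~ a" := (Neg a) : fm_scope.
Notation "a /\ b" := (And a b) : fm_scope.
Notation "a \/ b" := (Or a b) : fm_scope.

Fixpoint fm_encode (a : fm) : GenTree.tree nat :=
  match a with
  | Var i => GenTree.Leaf i
  | Bot => GenTree.Node 0 [::]
  | Top => GenTree.Node 1 [::]
  | Neg b => GenTree.Node 2 [:: fm_encode b]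
  | And b c => GenTree.Node 3 [:: fm_encode b; fm_encode c]
  | Or b c => GenTree.Node 4 [:: fm_encode b; fm_encode c]
  end.

Fixpoint fm_decode (t : GenTree.tree nat) : fm :=
  match t with
  | GenTree.Leaf i => Var i
  | GenTree.Node 1 [::] => Top
  | GenTree.Node 2 [:: u] => Neg (fm_decode u)
  | GenTree.Node 3 [:: u; v] => And (fm_decode u) (fm_decode v)
  | GenTree.Node 4 [:: u; v] => Or (fm_decode u) (fm_decode v)
  | _ => Bot
  end.

Lemma fm_encodeK : cancel fm_encode fm_decode.
Proof. by elim=> //= [a ->|a -> b ->|a -> b ->]. Qed.

HB.instance Definition _ := Countable.copy fm (can_type fm_encodeK).

Definition negk (k : nat) (a : fm) : fm := iter k Neg a.

Fixpoint subst (s : nat -> fm) (a : fm) : fm :=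
  match a with
  | Var i => s i
  | Bot => Bot
  | Top => Top
  | Neg b => Neg (subst s b)
  | And b c => And (subst s b) (subst s c)
  | Or b c => Or (subst s b) (subst s c)
  end.

HB.mixin Record isOckham (d : Order.disp_t) T & Order.TBDistrLattice d T := {
  neg : T -> T;
  neg_bot : neg \bot%O = \top%O;
  neg_join : forall x y, neg (x `|` y)%O = (neg x `&` neg y)%O;
  neg_top : neg \top%O = \bot%O;
  neg_meet : forall x y, neg (x `&` y)%O = (neg x `|` neg y)%O
}.

#[short(type="ockhamType")]
HB.structure Definition Ockham (d : Order.disp_t) :=
  {T of isOckham d T & Order.TBDistrLattice d T}.

Definition berman (m n : nat) (d : Order.disp_t) (A : ockhamType d) : Prop :=
  forall x : A, iter (2 * m + n) neg x = iter n neg x.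

Definition lattice_filter (d : Order.disp_t) (A : ockhamType d)
    (F : set A) : Prop :=
  (forall x y, F x -> F y -> F (x `&` y)%O) /\
  (forall x y, (x <= y)%O -> F x -> F y).

Record fm_hom (d : Order.disp_t) (A : ockhamType d) (h : fm -> A) : Prop := {
  hom_bot : h Bot = \bot%O;
  hom_top : h Top = \top%O;
  hom_neg : forall a, h (~ a)%F = neg (h a);
  hom_and : forall a b, h (a /\ b)%F = (h a `&` h b)%O;
  hom_or : forall a b, h (a \/ b)%F = (h a `|` h b)%O
}.

Definition entails_le (m n : nat) (G : set fm) (a : fm) : Prop :=
  forall (d : Order.disp_t) (A : ockhamType d), berman m n A ->
  forall F : set A, F !=set0 -> lattice_filter F ->
  forall h : fm -> A, fm_hom h -> h @` G `<=` F -> F (h a).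

(* Premises and conclusion. *)
Definition rule : Type := (seq fm * fm)%type.

Inductive derives (R : set rule) (G : set fm) : fm -> Prop :=
| derives_hyp a : G a -> derives R G a
| derives_rule (r : rule) (s : nat -> fm) :
    R r -> (forall b, b \in r.1 -> derives R G (subst s b)) ->
    derives R G (subst s r.2).

(* Pairs (a, b) of formulas stand for equations a ~ b or for one-premise
   rules a / b. *)
Definition rule1 (r : fm * fm) : rule := ([:: r.1], r.2).

Section Rules.
Local Open Scope fm_scope.

Local Notation x := (Var 0).
Local Notation y := (Var 1).
Local Notation z := (Var 2).

Definition Eqs (m n : nat) : seq (fm * fm) :=
  [:: (x \/ y, y \/ x);
      (x /\ y, y /\ x);
      (x \/ (y \/ z), (x \/ y) \/ z);
      (x /\ (y /\ z), (x /\ y) /\ z);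
      (x \/ x, x);
      (x /\ x, x);
      (x \/ (x /\ y), x);
      (x /\ (x \/ y), x);
      (x /\ Bot, Bot);
      (x \/ Top, Top);
      (x /\ (y \/ z), (x /\ y) \/ (x /\ z));
      (~ Bot, Top);
      (~ (x \/ y), ~ x /\ ~ y);
      (~ Top, Bot);
      (~ (x /\ y), ~ x \/ ~ y);
      (negk (2 * m + n) x, negk n x)].

Local Notation p := (Var 0).
Local Notation q := (Var 1).

Definition rules_Eq (m n : nat) : set (fm * fm) :=
  [set r | (r.1, r.2) \in Eqs m n \/ (r.2, r.1) \in Eqs m n]%type.

Definition rules_and (m n : nat) : set (fm * fm) :=
  rules_Eq m n `|` [set (p /\ q, p); (p /\ q, q)].

(* A strict upper bound on the indices of the variables of a. *)
Fixpoint var_bound (a : fm) : nat :=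
  match a with
  | Var i => i.+1
  | Bot | Top => 0
  | Neg b => var_bound b
  | And b c | Or b c => maxn (var_bound b) (var_bound c)
  end.

Definition s_ (k : nat) (r : fm * fm) : fm * fm :=
  let t := Var (maxn (var_bound r.1) (var_bound r.2)) in
  if odd k then (negk k r.2 \/ t, negk k r.1 \/ t)
  else (negk k r.1 \/ t, negk k r.2 \/ t).

Definition Omn (m n : nat) : set rule :=
  rule1 @` rules_and m n
  `|` [set rule1 (s_ i r) | i in [set i | (i <= 2 * m + n)%N]
                          & r in rules_and m n]
  `|` [set ([:: p; q], p /\ q)].

Definition top_rule : rule := ([::], Top).

End Rules.

(* Main.v *)
From HB Require Import structures.
Require Import Defs.
From mathcomp Require Import all_boot all_order classical_sets.
From mathcomp Require Import boolp.
Local Open Scope classical_set_scope.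

(** Soundness holds rule by rule, as [neg] is antitone and the rules in
    [rules_and] hold as inequalities. For completeness, fix the set [G] of
    premises and let [fm_le a b] mean that, for every [k] and every side
    disjunct [t], the implication between derivability of [negk k a \/ t] and
    of [negk k b \/ t] holds, in the direction dictated by the parity of [k].
    The rules [s_ i r] put every instance of [rules_and] into this relation;
    bounding [i] by [2 * m + n] suffices because, as [m >= 1], larger [k] can be
    lowered by the even period [2 * m]. Pushing negations inwards shows that the
    preorder [fm_le] is monotone in the lattice connectives; by the shift in [k]
    it is antitone in negation. Its quotient is a Berman algebra in which the
    derivable formulas form a filter. *)

Set Implicit Arguments.
Unset Strict Implicit.
Unset Printing Implicit Defensive.

Import Order.TTheory.
Local Open Scope quotient_scope.

(** * Substitution and iterated negation *)

Lemma subst_negk s k a : subst s (negk k a) = negk k (subst s a).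
Proof. by elim: k => //= k ->. Qed.

Lemma negkSr k a : negk k.+1 a = negk k (Neg a).
Proof. exact: iterSr. Qed.

(** This is what makes the side variable of [s_ k r] fresh: its value can be chosen at will without
    disturbing the instance of [r]. *)
Lemma eq_subst s s' a :
  (forall i, i < var_bound a -> s i = s' i) -> subst s a = subst s' a.
Proof.
elim: a => //= [i|a IHa|a IHa b IHb|a IHa b IHb] eq_s; first exact: eq_s.
- by rewrite IHa.
- by rewrite IHa ?IHb // => i lt_i; apply: eq_s; rewrite leq_max lt_i ?orbT.
- by rewrite IHa ?IHb // => i lt_i; apply: eq_s; rewrite leq_max lt_i ?orbT.
Qed.

(** * Soundness *)

Section Soundness.
Variables (d : Order.disp_t) (A : ockhamType d).

Lemma neg_anti (x y : A) : (x <= y)%O -> (neg y <= neg x)%O.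
Proof. by move=> /join_idPl <-; rewrite neg_join leIr. Qed.

Lemma iter_neg_mono k (x y : A) : (x <= y)%O ->
  if odd k then (iter k neg y <= iter k neg x)%O
  else (iter k neg x <= iter k neg y)%O.
Proof.
move=> le_xy; elim: k => //= k.
by case: (odd k) => /= /neg_anti.
Qed.

Lemma hom_negk (h : fm -> A) k a : fm_hom h -> h (negk k a) = iter k neg (h a).
Proof. by move=> hh; elim: k => //= k <-; rewrite hom_neg. Qed.

Lemma hom_subst (h : fm -> A) s : fm_hom h -> fm_hom (h \o subst s).
Proof. by case=> *; split=> /=. Qed.

Lemma hom_Eqs m n (h : fm -> A) a b : berman m n A -> fm_hom h ->
  (a, b) \in Eqs m n -> h a = h b.
Proof.
move=> bA hh.
have hE := (hom_or hh, hom_and hh, hom_neg hh, hom_top hh, hom_bot hh).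
rewrite !inE.
case/predU1P=> [[-> ->]|]; first by rewrite !hE joinC.
case/predU1P=> [[-> ->]|]; first by rewrite !hE meetC.
case/predU1P=> [[-> ->]|]; first by rewrite !hE joinA.
case/predU1P=> [[-> ->]|]; first by rewrite !hE meetA.
case/predU1P=> [[-> ->]|]; first by rewrite !hE joinxx.
case/predU1P=> [[-> ->]|]; first by rewrite !hE meetxx.
case/predU1P=> [[-> ->]|]; first by rewrite !hE meetKU.
case/predU1P=> [[-> ->]|]; first by rewrite !hE joinKI.
case/predU1P=> [[-> ->]|]; first by rewrite !hE meetx0.
case/predU1P=> [[-> ->]|]; first by rewrite !hE joinx1.
case/predU1P=> [[-> ->]|]; first by rewrite !hE meetUr.
case/predU1P=> [[-> ->]|]; first by rewrite !hE neg_bot.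
case/predU1P=> [[-> ->]|]; first by rewrite !hE neg_join.
case/predU1P=> [[-> ->]|]; first by rewrite !hE neg_top.
case/predU1P=> [[-> ->]|]; first by rewrite !hE neg_meet.
by move/eqP=> [-> ->]; rewrite !hom_negk.
Qed.

Lemma hom_rules_and m n (h : fm -> A) r : berman m n A -> fm_hom h ->
  rules_and m n r -> (h r.1 <= h r.2)%O.
Proof.
move=> bA hh [[]|[]] => [/(hom_Eqs bA hh)->|/(hom_Eqs bA hh)->|->|->] //=.
- by rewrite hom_and // leIl.
- by rewrite hom_and // leIr.
Qed.

Lemma hom_s_ m n (h : fm -> A) k r : berman m n A -> fm_hom h ->
  rules_and m n r -> (h (s_ k r).1 <= h (s_ k r).2)%O.
Proof.
move=> bA hh /(hom_rules_and bA hh)/(iter_neg_mono k); rewrite /s_.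
by case: odd => /= le_h; rewrite !hom_or // !hom_negk // leU2.
Qed.

Lemma filter_derives m n (F : set A) (h : fm -> A) G a : berman m n A ->
  F !=set0 -> lattice_filter F -> fm_hom h -> h @` G `<=` F ->
  derives (Omn m n `|` [set top_rule]) G a -> F (h a).
Proof.
move=> bA [x Fx] [FI Fle] hh GF; elim=> [b Gb|r s Rr _ IH].
  by apply: GF; exists b.
have hs := hom_subst s hh.
(* As [F] is upward closed, a one-premise rule only requires an inequality under every homomorphism,
   here [h \o subst s]. *)
have rule1F r' : rule1 r' = r -> (h (subst s r'.1) <= h (subst s r'.2))%O ->
    F (h (subst s r.2)).
  by move=> r'E /Fle; rewrite -r'E; apply; apply: IH; rewrite -r'E inE.
case: Rr => [[[[r' Rr' r'E]|[k _ [r' Rr' r'E]]]|rE]|rE].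
- exact: rule1F r'E (hom_rules_and bA hs Rr').
- exact: rule1F r'E (hom_s_ k bA hs Rr').
- rewrite rE /= hom_and //.
  by apply: FI; [apply: (IH (Var 0))|apply: (IH (Var 1))];
    rewrite rE !inE eqxx ?orbT.
(* Nonemptiness of [F] is what validates [top_rule]. *)
- by rewrite rE /= hom_top //; apply: Fle Fx; rewrite lex1.
Qed.

End Soundness.

(** * Derivability from a fixed set of premises *)

Section Completeness.
Variables (m n : nat) (G : set fm).
(** The first parameter is [m.+1] throughout the section, so that the period [2 * m.+1] is
    positive. *)
Local Notation N := (2 * m.+1 + n).

Definition derivable := derives (Omn m.+1 n `|` [set top_rule]) G.
Local Notation D := derivable.

Lemma derivable_rule r s : (Omn m.+1 n `|` [set top_rule]) r ->
  (forall b, b \in r.1 -> D (subst s b)) -> D (subst s r.2).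
Proof. exact: derives_rule. Qed.

Lemma derivable_rule1 r s : rules_and m.+1 n r ->
  D (subst s r.1) -> D (subst s r.2).
Proof.
move=> Rr Da; apply: (@derivable_rule (rule1 r)).
  by left; left; left; exists r.
by move=> b; rewrite inE => /eqP->.
Qed.

(** * Lattice laws under a side disjunct *)

Definition pre_le a b := forall t, D (a \/ t)%F -> D (b \/ t)%F.

Lemma pre_le_trans b a c : pre_le a b -> pre_le b c -> pre_le a c.
Proof. by move=> ab bc t /ab /bc. Qed.

Lemma pre_le_rule k r s : k <= N -> rules_and m.+1 n r ->
  if odd k then pre_le (negk k (subst s r.2)) (negk k (subst s r.1))
  else pre_le (negk k (subst s r.1)) (negk k (subst s r.2)).
Proof.
move=> le_kN Rr.
(* [s'] sends the side variable of [s_ k r] to [t] and agrees with [s] on the variables of [r]. *)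
have Ds t : let r' := s_ k r in
    let s' i := if i == maxn (var_bound r.1) (var_bound r.2) then t else s i in
    D (subst s' r'.1) -> D (subst s' r'.2).
  move=> r' s' Da; apply: (@derivable_rule (rule1 r')).
    by left; left; right; exists k => //; exists r.
  by move=> b; rewrite inE => /eqP->.
have r1E t : subst (fun i => if i == maxn (var_bound r.1) (var_bound r.2)
    then t else s i) r.1 = subst s r.1.
  by apply: eq_subst => i lt_i; rewrite ltn_eqF // leq_max lt_i.
have r2E t : subst (fun i => if i == maxn (var_bound r.1) (var_bound r.2)
    then t else s i) r.2 = subst s r.2.
  by apply: eq_subst => i lt_i; rewrite ltn_eqF // leq_max lt_i orbT.
by move: Ds; rewrite /s_; case: ifP => _ Ds t; move: (Ds t) => /=;
  rewrite !subst_negk r1E r2E eqxx.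
Qed.

(* Equations are referred to below by their position in [Eqs]; [sub3 a b c]
   instantiates their variables x, y, z. *)
Definition sub3 (a b c : fm) (i : nat) := nth c [:: a; b] i.

(** [Eqs] has 16 entries, so the default [(Bot, Bot)] is never reached. *)
Lemma rules_and_Eqs i : i < 16 ->
  let r := nth (Bot, Bot) (Eqs m.+1 n) i in
  rules_and m.+1 n (r.1, r.2) /\ rules_and m.+1 n (r.2, r.1).
Proof.
move=> lt_i r.
have r_in : (r.1, r.2) \in Eqs m.+1 n by rewrite -surjective_pairing mem_nth.
by split; left; [left | right].
Qed.

Lemma derivable_Eqs i s : i < 16 ->
  let r := nth (Bot, Bot) (Eqs m.+1 n) i in
  D (subst s r.1) <-> D (subst s r.2).
Proof.
by move=> /rules_and_Eqs[lr rl]; split;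
  [exact: (derivable_rule1 (s := s) lr) | exact: (derivable_rule1 (s := s) rl)].
Qed.

Lemma pre_le_Eqs i s : i < 16 ->
  let r := nth (Bot, Bot) (Eqs m.+1 n) i in
  pre_le (subst s r.1) (subst s r.2) /\ pre_le (subst s r.2) (subst s r.1).
Proof.
move=> /rules_and_Eqs[lr rl].
by split; [exact: (@pre_le_rule 0 _ s _ lr) | exact: (@pre_le_rule 0 _ s _ rl)].
Qed.

Lemma derivable_orC a b : D (a \/ b)%F -> D (b \/ a)%F.
Proof. by case: (@derivable_Eqs 0 (sub3 a b b) isT). Qed.

Lemma derivable_orA a b c : D (a \/ (b \/ c))%F <-> D ((a \/ b) \/ c)%F.
Proof. exact: (@derivable_Eqs 2 (sub3 a b c) isT). Qed.

Lemma derivable_orr a : D (a \/ a)%F -> D a.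
Proof. by case: (@derivable_Eqs 4 (sub3 a a a) isT). Qed.

(** Absorption turns [a] into [a /\ (a \/ b)], from which the second projection extracts the
    disjunction. *)
Lemma derivable_orl a b : D a -> D (a \/ b)%F.
Proof.
case: (@derivable_Eqs 7 (sub3 a b b) isT) => _ /= /[apply].
apply: (@derivable_rule1 (Var 0 /\ Var 1, Var 1)%F (sub3 a (a \/ b)%F a)).
by right; right.
Qed.

Lemma derivable_and a b : D a -> D b -> D (a /\ b)%F.
Proof.
move=> Da Db.
apply: (@derivable_rule ([:: Var 0; Var 1], Var 0 /\ Var 1)%F (sub3 a b b)).
  by left; right.
by move=> c; rewrite !inE => /orP[] /eqP->.
Qed.

Lemma derivable_top : D Top.
Proof. by apply: (@derivable_rule top_rule Var) => //; right. Qed.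

(** Taking [b] itself as side disjunct leads from [a] to [a \/ b], then to [b \/ b], which contracts
    to [b]. *)
Lemma pre_le_derivable a b : pre_le a b -> D a -> D b.
Proof. by move=> ab Da; apply/derivable_orr/ab/derivable_orl. Qed.

Lemma pre_le_andl a b : pre_le (a /\ b)%F a.
Proof.
apply: (@pre_le_rule 0 (Var 0 /\ Var 1, Var 0)%F (sub3 a b b)) => //.
by right; left.
Qed.
Arguments pre_le_andl : clear implicits.

Lemma pre_le_andr a b : pre_le (a /\ b)%F b.
Proof.
apply: (@pre_le_rule 0 (Var 0 /\ Var 1, Var 1)%F (sub3 a b b)) => //.
by right; right.
Qed.
Arguments pre_le_andr : clear implicits.

Lemma pre_le_orC a b : pre_le (a \/ b)%F (b \/ a)%F.
Proof. by case: (@pre_le_Eqs 0 (sub3 a b b) isT). Qed.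
Arguments pre_le_orC : clear implicits.

Lemma pre_le_orl a b : pre_le a (a \/ b)%F.
Proof.
case: (@pre_le_Eqs 7 (sub3 a b b) isT) => _ /pre_le_trans; apply.
exact: (pre_le_andr _ _).
Qed.
Arguments pre_le_orl : clear implicits.

(** Reassociation makes [b \/ t] the side disjunct while [a] is replaced, and after a swap [a' \/ t]
    plays that part for [b]. *)
Lemma pre_le_or a a' b b' :
  pre_le a a' -> pre_le b b' -> pre_le (a \/ b)%F (a' \/ b')%F.
Proof.
move=> aa' bb' t /derivable_orA/aa'/derivable_orA/(pre_le_orC _ _).
by move/derivable_orA/bb'/derivable_orA/(pre_le_orC _ _).
Qed.

Lemma pre_le_orr a b : pre_le b (a \/ b)%F.
Proof. exact: pre_le_trans (pre_le_orl b a) (pre_le_orC b a). Qed.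
Arguments pre_le_orr : clear implicits.

Lemma pre_le_lub a b c : pre_le a c -> pre_le b c -> pre_le (a \/ b)%F c.
Proof.
move=> ac bc; apply: pre_le_trans (pre_le_or ac bc) _.
by case: (@pre_le_Eqs 4 (sub3 c c c) isT).
Qed.

(** The rule introducing conjunctions comes without a side disjunct. It is applied to [a \/ t] and
    [b \/ t], and distributivity, used twice, then leads to [(a /\ b) \/ t]. *)
Lemma pre_le_glb a b c : pre_le c a -> pre_le c b -> pre_le c (a /\ b)%F.
Proof.
move=> ca cb t Dc; have := derivable_and (ca t Dc) (cb t Dc).
have distr x y z : pre_le (x /\ (y \/ z))%F (x /\ y \/ x /\ z)%F.
  by case: (@pre_le_Eqs 10 (sub3 x y z) isT).
have andC x y : pre_le (x /\ y)%F (y /\ x)%F.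
  by case: (@pre_le_Eqs 1 (sub3 x y y) isT).
apply: pre_le_derivable; apply: (pre_le_trans (distr _ _ _)).
apply: pre_le_lub; last first.
  exact: pre_le_trans (pre_le_andr _ _) (pre_le_orr _ _).
apply: (pre_le_trans (andC _ _)); apply: (pre_le_trans (distr _ _ _)).
by apply: pre_le_or; [exact: andC | exact: pre_le_andr].
Qed.

Lemma pre_le_and a a' b b' :
  pre_le a a' -> pre_le b b' -> pre_le (a /\ b)%F (a' /\ b')%F.
Proof.
move=> aa' bb'; apply: pre_le_glb.
- exact: pre_le_trans (pre_le_andl _ _) aa'.
- exact: pre_le_trans (pre_le_andr _ _) bb'.
Qed.

(** * The preorder stable under iterated negation *)

Definition fm_le a b := forall k,
  if odd k then pre_le (negk k b) (negk k a) else pre_le (negk k a) (negk k b).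

Lemma fm_le_pre a b : fm_le a b -> pre_le a b.
Proof. by move=> ab; exact: (ab 0). Qed.

Lemma fm_le_refl a : fm_le a a.
Proof. by move=> k; case: odd. Qed.

Lemma fm_le_trans b a c : fm_le a b -> fm_le b c -> fm_le a c.
Proof.
move=> ab bc k; have := bc k; have := ab k.
by case: odd => ab' bc';
  [exact: pre_le_trans bc' ab' | exact: pre_le_trans ab' bc'].
Qed.

Lemma fm_le_neg a b : fm_le a b -> fm_le (~ b)%F (~ a)%F.
Proof.
move=> ab k; have := ab k.+1.
by rewrite !negkSr /=; case: odd.
Qed.

(** With [k = N + j], this is the last equation of [Eqs] instantiated at [negk j a]. *)
Lemma negk_period k a : N <= k ->
  pre_le (negk k a) (negk (k - 2 * m.+1) a) /\
  pre_le (negk (k - 2 * m.+1) a) (negk k a).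
Proof.
move=> le_Nk.
have [j ->] : exists j, k = N + j by exists (k - N); rewrite subnKC.
have -> : N + j - 2 * m.+1 = n + j by rewrite -addnA addKn.
have := @pre_le_Eqs 15 (sub3 (negk j a) a a) isT.
by rewrite /= !subst_negk /negk -!iterD.
Qed.

Lemma fm_le_rule r s : rules_and m.+1 n r ->
  fm_le (subst s r.1) (subst s r.2).
Proof.
move=> Rr k; elim/ltn_ind: k => k IHk.
have [le_kN|/ltnW lt_Nk] := leqP k N; first exact: pre_le_rule.
(* Removing one period strictly lowers [k] and keeps its parity, hence also the direction of the
   induction hypothesis. *)
have lt_k : k - 2 * m.+1 < k.
  by rewrite ltn_subrL mulnS /= (leq_trans _ lt_Nk) // mulnS.
have oddk : odd (k - 2 * m.+1) = odd k.
  by rewrite oddB ?oddM ?addbF // (leq_trans (leq_addr n _)).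
have [a1 a2] := @negk_period k (subst s r.1) lt_Nk.
have [b1 b2] := @negk_period k (subst s r.2) lt_Nk.
move: (IHk _ lt_k); rewrite oddk; case: odd => IH.
  exact: pre_le_trans b1 (pre_le_trans IH a2).
exact: pre_le_trans a1 (pre_le_trans IH b2).
Qed.

Definition fm_eqv a b := fm_le a b /\ fm_le b a.

Lemma fm_eqv_refl a : fm_eqv a a.
Proof. by split; apply: fm_le_refl. Qed.

Lemma fm_eqv_sym a b : fm_eqv a b -> fm_eqv b a.
Proof. by case. Qed.

Lemma fm_eqv_trans b a c : fm_eqv a b -> fm_eqv b c -> fm_eqv a c.
Proof.
move=> [ab ba] [bc cb].
by split; [exact: fm_le_trans ab bc | exact: fm_le_trans cb ba].
Qed.

Lemma fm_eqv_Eqs i s : i < 16 ->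
  let r := nth (Bot, Bot) (Eqs m.+1 n) i in
  fm_eqv (subst s r.1) (subst s r.2).
Proof.
move=> /rules_and_Eqs[lr rl].
by split; [exact: (fm_le_rule s lr) | exact: (fm_le_rule s rl)].
Qed.

Definition pre_eqv a b := pre_le a b /\ pre_le b a.

Lemma fm_eqv_negk k a b : fm_eqv a b -> pre_eqv (negk k a) (negk k b).
Proof. by case=> /(_ k) + /(_ k); case: odd. Qed.

Lemma pre_eqv_trans b a c : pre_eqv a b -> pre_eqv b c -> pre_eqv a c.
Proof.
move=> [ab ba] [bc cb].
by split; [exact: pre_le_trans ab bc | exact: pre_le_trans cb ba].
Qed.

(** The innermost negation moves first: the De Morgan equations hold up to [fm_eqv], so they survive
    under [negk k], and the induction hypothesis applies to [~ a] and [~ b]. *)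
Lemma negk_and_or k a b :
  pre_eqv (negk k (a /\ b)) (if odd k then negk k a \/ negk k b
                             else negk k a /\ negk k b)%F /\
  pre_eqv (negk k (a \/ b)) (if odd k then negk k a /\ negk k b
                             else negk k a \/ negk k b)%F.
Proof.
elim: k a b => [|k IHk] a b; first by do 2!split.
have [IHand IHor] := IHk (~ a)%F (~ b)%F.
rewrite !negkSr oddS; split.
- apply: (@pre_eqv_trans (negk k (~ a \/ ~ b))).
    exact: fm_eqv_negk (@fm_eqv_Eqs 14 (sub3 a b b) isT).
  by move: IHor; case: odd.
- apply: (@pre_eqv_trans (negk k (~ a /\ ~ b))).
    exact: fm_eqv_negk (@fm_eqv_Eqs 12 (sub3 a b b) isT).
  by move: IHand; case: odd.
Qed.

(** At odd [k] the conjunctions become disjunctions, so both [pre_le_or] and [pre_le_and] are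
    used. *)
Lemma fm_le_and a a' b b' :
  fm_le a a' -> fm_le b b' -> fm_le (a /\ b)%F (a' /\ b')%F.
Proof.
move=> aa' bb' k.
have [[ab1 ab2] _] := negk_and_or k a b.
have [[ab'1 ab'2] _] := negk_and_or k a' b'.
move: (aa' k) (bb' k) ab1 ab2 ab'1 ab'2.
case: odd => aa'k bb'k ab1 ab2 ab'1 ab'2.
  exact: pre_le_trans ab'1 (pre_le_trans (pre_le_or aa'k bb'k) ab2).
exact: pre_le_trans ab1 (pre_le_trans (pre_le_and aa'k bb'k) ab'2).
Qed.

Lemma fm_le_or a a' b b' :
  fm_le a a' -> fm_le b b' -> fm_le (a \/ b)%F (a' \/ b')%F.
Proof.
move=> aa' bb' k.
have [_ [ab1 ab2]] := negk_and_or k a b.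
have [_ [ab'1 ab'2]] := negk_and_or k a' b'.
move: (aa' k) (bb' k) ab1 ab2 ab'1 ab'2.
case: odd => aa'k bb'k ab1 ab2 ab'1 ab'2.
  exact: pre_le_trans ab'1 (pre_le_trans (pre_le_and aa'k bb'k) ab2).
exact: pre_le_trans ab1 (pre_le_trans (pre_le_or aa'k bb'k) ab'2).
Qed.

(** * The Lindenbaum algebra of [G] *)

Definition fm_eqvb a b := `[< fm_eqv a b >].

Lemma fm_eqvb_refl : reflexive fm_eqvb.
Proof. by move=> a; apply/asboolP/fm_eqv_refl. Qed.

Lemma fm_eqvb_sym : symmetric fm_eqvb.
Proof. by move=> a b; apply/asboolP/asboolP => /fm_eqv_sym. Qed.

Lemma fm_eqvb_trans : transitive fm_eqvb.
Proof.
by move=> b a c /asboolP ab /asboolP bc; apply/asboolP/(fm_eqv_trans ab bc).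
Qed.

Canonical fm_eqvb_equiv :=
  EquivRel fm_eqvb fm_eqvb_refl fm_eqvb_sym fm_eqvb_trans.

Definition lindenbaum := {eq_quot fm_eqvb}.
HB.instance Definition _ := Choice.on lindenbaum.
Local Notation cls := (\pi_{eq_quot fm_eqvb} : fm -> lindenbaum).
Local Notation rep := (repr : lindenbaum -> fm).

Lemma clsP a b : cls a = cls b <-> fm_eqv a b.
Proof. by split=> [/eqmodP/asboolP|ab]; last apply/eqmodP/asboolP. Qed.

Lemma rep_cls a : fm_eqv (rep (cls a)) a.
Proof. by apply/clsP; rewrite reprK. Qed.

(** The operations act on chosen representatives; monotonicity and antitonicity of the connectives
    make the choice irrelevant. *)
Definition lmeet := lift_op2 lindenbaum And.
Definition ljoin := lift_op2 lindenbaum Or.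
Definition lneg := lift_op1 lindenbaum Neg.

Lemma lmeetE a b : lmeet (cls a) (cls b) = cls (a /\ b)%F.
Proof.
rewrite /lmeet -lock; have [a1 a2] := rep_cls a; have [b1 b2] := rep_cls b.
by apply/clsP; split; apply: fm_le_and.
Qed.

Lemma ljoinE a b : ljoin (cls a) (cls b) = cls (a \/ b)%F.
Proof.
rewrite /ljoin -lock; have [a1 a2] := rep_cls a; have [b1 b2] := rep_cls b.
by apply/clsP; split; apply: fm_le_or.
Qed.

Lemma lnegE a : lneg (cls a) = cls (~ a)%F.
Proof.
rewrite /lneg -lock; have [a1 a2] := rep_cls a.
by apply/clsP; split; apply: fm_le_neg.
Qed.

Lemma cls_Eqs i s : i < 16 ->
  let r := nth (Bot, Bot) (Eqs m.+1 n) i in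
  cls (subst s r.1) = cls (subst s r.2).
Proof. by move=> lt_i r; apply/clsP/fm_eqv_Eqs. Qed.

Lemma lmeetC : commutative lmeet.
Proof.
elim/quotW=> a; elim/quotW=> b; rewrite !lmeetE.
exact: (@cls_Eqs 1 (sub3 a b b)).
Qed.

Lemma ljoinC : commutative ljoin.
Proof.
elim/quotW=> a; elim/quotW=> b; rewrite !ljoinE.
exact: (@cls_Eqs 0 (sub3 a b b)).
Qed.

Lemma lmeetA : associative lmeet.
Proof.
elim/quotW=> a; elim/quotW=> b; elim/quotW=> c; rewrite !lmeetE.
exact: (@cls_Eqs 3 (sub3 a b c)).
Qed.

Lemma ljoinA : associative ljoin.
Proof.
elim/quotW=> a; elim/quotW=> b; elim/quotW=> c; rewrite !ljoinE.
exact: (@cls_Eqs 2 (sub3 a b c)).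
Qed.

Lemma ljoinKI v u : lmeet u (ljoin u v) = u.
Proof.
elim/quotW: u v => a; elim/quotW=> b; rewrite ljoinE lmeetE.
exact: (@cls_Eqs 7 (sub3 a b b)).
Qed.

Lemma lmeetKU v u : ljoin u (lmeet u v) = u.
Proof.
elim/quotW: u v => a; elim/quotW=> b; rewrite lmeetE ljoinE.
exact: (@cls_Eqs 6 (sub3 a b b)).
Qed.

Lemma lmeetUl : left_distributive lmeet ljoin.
Proof.
move=> u v w; rewrite !(lmeetC _ w).
elim/quotW: u v w => a; elim/quotW=> b; elim/quotW=> c.
rewrite !(lmeetE, ljoinE); exact: (@cls_Eqs 10 (sub3 c a b)).
Qed.

Lemma lmeetxx : idempotent_op lmeet.
Proof. by elim/quotW=> a; rewrite lmeetE; exact: (@cls_Eqs 5 (sub3 a a a)). Qed.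

Definition lle (u v : lindenbaum) := lmeet u v == u.
Definition llt (u v : lindenbaum) := (v != u) && lle u v.

HB.instance Definition _ :=
  Order.isMeetJoinDistrLattice.Build (Order.Disp tt tt) lindenbaum
  (fun _ _ => erefl) (fun _ _ => erefl : llt _ _ = _) lmeetC ljoinC
  lmeetA ljoinA ljoinKI lmeetKU lmeetUl lmeetxx.

Lemma meetE a b : (cls a `&` cls b)%O = cls (a /\ b)%F.
Proof. exact: lmeetE. Qed.

Lemma joinE a b : (cls a `|` cls b)%O = cls (a \/ b)%F.
Proof. exact: ljoinE. Qed.

Lemma lbot_le u : (cls Bot <= u)%O.
Proof.
apply/meet_idPl; rewrite meetC; elim/quotW: u => a; rewrite meetE.
exact: (@cls_Eqs 8 (sub3 a a a)).
Qed.

Lemma le_ltop u : (u <= cls Top)%O.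
Proof.
apply/join_idPl; rewrite joinC; elim/quotW: u => a; rewrite joinE.
exact: (@cls_Eqs 9 (sub3 a a a)).
Qed.

HB.instance Definition _ :=
  @Order.hasBottom.Build _ lindenbaum (cls Bot) lbot_le.
HB.instance Definition _ := @Order.hasTop.Build _ lindenbaum (cls Top) le_ltop.

Lemma lneg_bot : lneg \bot%O = \top%O.
Proof. by rewrite lnegE; exact: (@cls_Eqs 11 Var). Qed.

Lemma lneg_top : lneg \top%O = \bot%O.
Proof. by rewrite lnegE; exact: (@cls_Eqs 13 Var). Qed.

Lemma lneg_join u v : lneg (u `|` v)%O = (lneg u `&` lneg v)%O.
Proof.
elim/quotW: u v => a; elim/quotW=> b; rewrite joinE !lnegE meetE.
exact: (@cls_Eqs 12 (sub3 a b b)).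
Qed.

Lemma lneg_meet u v : lneg (u `&` v)%O = (lneg u `|` lneg v)%O.
Proof.
elim/quotW: u v => a; elim/quotW=> b; rewrite meetE !lnegE joinE.
exact: (@cls_Eqs 14 (sub3 a b b)).
Qed.

HB.instance Definition _ := @isOckham.Build _ lindenbaum
  lneg lneg_bot lneg_join lneg_top lneg_meet.

Lemma lindenbaum_berman : berman m.+1 n lindenbaum.
Proof.
have iterE k a : iter k neg (cls a) = cls (negk k a).
  by elim: k => //= k ->; exact: lnegE.
elim/quotW=> a; rewrite !iterE.
by have := @cls_Eqs 15 (sub3 a a a) isT; rewrite /= !subst_negk.
Qed.

(** * The canonical homomorphism and filter *)

Lemma cls_hom : fm_hom cls.
Proof.
split=> // *; first by rewrite -lnegE.
- by rewrite meetE.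
- by rewrite joinE.
Qed.

(** The quotient order says that [a] lies below [a /\ b], which lies below [b] by the second
    projection rule. *)
Lemma cls_le a b : (cls a <= cls b)%O -> fm_le a b.
Proof.
move=> /meet_idPl; rewrite meetE => /clsP[_ a_le]; apply: fm_le_trans a_le _.
by apply: (@fm_le_rule (Var 0 /\ Var 1, Var 1)%F (sub3 a b b)); right; right.
Qed.

Lemma entails_le_derivable a : entails_le m.+1 n G a -> D a.
Proof.
(* The entailment is tested on the classes of derivable formulas under the canonical map. Equivalent
   formulas are derivable together, so representatives do not matter. *)
pose F : set lindenbaum := [set u | D (rep u)].
have clsF b : F (cls b) <-> D b.
  have [b1 b2] := rep_cls b.
  by split; [exact: (pre_le_derivable (fm_le_pre b1)) |
             exact: (pre_le_derivable (fm_le_pre b2))].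
move=> /(_ _ lindenbaum lindenbaum_berman F) => H; apply/clsF/H.
- by exists (cls Top); apply/clsF/derivable_top.
- split; elim/quotW=> b; elim/quotW=> c.
    by move=> /clsF Db /clsF Dc; rewrite meetE; apply/clsF/derivable_and.
  by move=> /cls_le/fm_le_pre bc /clsF Db; apply/clsF/(pre_le_derivable bc Db).
- exact: cls_hom.
- by move=> _ [b Gb <-]; apply/clsF/derives_hyp.
Qed.

End Completeness.

Theorem theorem5p2 (m n : nat) (hm : (1 <= m)%N) (G : set fm) (a : fm) :
  derives (Omn m n `|` [set top_rule]) G a <-> entails_le m n G a.
Proof.
split=> [Da d A bA F F0 FF h hh GF|]; last first.
  by case: m hm => // m _; exact: entails_le_derivable.
exact: (filter_derives bA F0 FF hh GF Da).
Qed.
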